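(* Let $p$ be a prime, $F$ an infinite field of characteristic $p$, $G$ a cyclic group of order $p$, and $V=lV_2+mV_3$ the direct sum of $l$ copies of $V_2$ and $m$ copies of $V_3$. Identify $F[V]$ with $F[x_i,y_j,z_r \mid 1\le i,j\le l+m,\ l+1\le r\le l+m]$, and let $$L=\{x_i, y_i^p \mid 1\le i\le l\}\cup\{x_i, y_iy_j, z_i^p \mid l+1\le i,j\le l+m,\ i\le j\},$$ a generating set of the Hilbert ideal $H(lV_2+mV_3)$. Then there is a monomial order such that $H(lV_2+mV_3)$ is Borel fixed. Furthermore, there are $(2l+3m)!$ generic initial ideals of $H(lV_2+mV_3)$ (as the monomial order varies over all monomial orders on $F[V]$). Each of them is generated by $\pi(L)$ for some permutation $\pi$ of the variables in $F[lV_2+mV_3]$.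
   Context: There are exactly $p$ indecomposable $G$-modules $V_1,\dots,V_p$ over $F$ up to isomorphism; $V_n$ is the module of dimension $n$ on which a generator of $G$ acts by a single Jordan block with $1$'s on the diagonal (so $V_n$ is defined only for $n\le p$). For a $G$-module $V$, $F[V]=S(V^* )$ is the symmetric algebra on $V^*$, a polynomial ring on a basis of $V^*$. The Hilbert ideal $H(V)$ is the ideal of $F[V]$ generated by all homogeneous $G$-invariants of positive degree. Here $\{x_i,y_i\}$ is a basis of a copy of $V_2^*$ for $1\le i\le l$, and $\{x_i,y_i,z_i\}$ is a basis of a copy of $V_3^*$ for $l+1\le i\le l+m$; it is a known result that, for suitable such bases, $L$ generates $H(lV_2+mV_3)$. A permutation of the variables acts on $F[V]$ by the corresponding $F$-algebra automorphism. Given a monomial order $>$ whose ranking of the $N$ variables is $u_1>u_2>\cdots>u_N$, an upper triangular matrix $\theta=(\theta_{ij})\in GL_N(F)$ acts by the $F$-algebra automorphism $u_j\mapsto\sum_{i\le j}\theta_{ij}u_i$; an ideal is Borel fixed (with respect to $>$) if it is mapped into itself by all such $\theta$. For a homogeneous ideal $I$ and monomial order $>$, $\operatorname{In}_>(I)$ is the ideal generated by initial monomials of elements of $I$, and $\operatorname{gin}_>(I)$ is the monomial ideal $J$ such that $\operatorname{In}_>(\alpha(I))=J$ for all $\alpha$ in a nonempty Zariski open subset of the group of invertible linear substitutions of the variables. The generic initial ideals of $I$ are the ideals $\operatorname{gin}_>(I)$ for the various monomial orders $>$.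
   Formalization: For l+m ≥ 2 fewer than (2l+3m)! distinct generic initial ideals exist (l=2, m=0: 6, not 24), so the count is of pairs (ranking of the variables, generic initial ideal); distinct ideals are counted only for l+m ≤ 1. The ideals are shown to be exactly those generated by the π(L). *)

(* Defs.v *)
From HB Require Import structures.
From mathcomp Require Import all_boot all_order all_algebra.
From mathcomp Require Import fingroup perm cyclic mxrepresentation.
From mathcomp Require Import classical_sets cardinality.
From mathcomp Require Import mpoly.

Set Implicit Arguments.
Unset Strict Implicit.
Unset Printing Implicit Defensive.

Import GRing.Theory.
Local Open Scope classical_set_scope.
Local Open Scope ring_scope.

(* Ideals are handled as Prop-valued sets, since no decidability is available. *)
Definition ideal_gen (R : comNzRingType) (S : set R) : set R :=
  [set f | exists cs : seq (R * R),
     (forall c, c \in cs -> S c.2) /\ f = \sum_(c <- cs) c.1 * c.2].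

Section Polynomials.
Variables (F : fieldType) (N : nat).
Implicit Types (A : 'M[F]_N) (f : {mpoly F[N]}) (I J : set {mpoly F[N]}).

(* The F-algebra map 'X_j |-> \sum_i A i j *: 'X_i. If the variables are read as
   the coordinate functions of the space of row vectors v, then it sends f to
   the function v |-> f (v *m A). *)
Definition linear_subst A f : {mpoly F[N]} :=
  f \mPo [tuple \sum_i A i j *: 'X_i | j < N].

(* A representation rG on N is a G-module V whose elements are row vectors; its
   coordinate functions form a basis of V^*, so that F[V] is {mpoly F[N]}. *)
Definition hilbert_ideal (gT : finGroupType) (G : {group gT})
    (rG : mx_representation F G N) : set {mpoly F[N]} :=
  ideal_gen [set f | (exists2 d : nat, (0 < d)%N & f \is d.-homog) /\
                     (forall h, h \in G -> linear_subst (rG h) f = f)].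

Definition jordan_block n : 'M[F]_n :=
  \matrix_(i, j) ((j == i) || (j == i.+1 :> nat))%:R.

(* The variables 'X_(u k), k < n, form a basis of a G-submodule of V^* that is
   isomorphic to V_n^*, where g generates G and p = #|G|. An element of V^* is
   a column vector and g acts on it by rG g *m _; the columns of
   colsub u 1%:M *m P are a basis of the span of the 'X_(u k) in which g acts
   by a Jordan block. *)
Definition spans_dual_copy (gT : finGroupType) (G : {group gT}) (g : gT)
    (rG : mx_representation F G N) n (u : 'I_n -> 'I_N) : Prop :=
  (n <= #|G|)%N /\
  exists2 P : 'M[F]_n, P \in unitmx &
    rG g *m (colsub u 1%:M *m P) = (colsub u 1%:M *m P) *m jordan_block n.

Record monomial_order := MonomialOrder {
  mo_le :> rel 'X_{1..N};
  mo_anti : antisymmetric mo_le;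
  mo_trans : transitive mo_le;
  mo_total : total mo_le;
  mo_le0 : forall a, mo_le 0%MM a;
  mo_leD : forall a b c, mo_le a b -> mo_le (a + c)%MM (b + c)%MM }.

(* The ranking of the variables is 'X_(s 0) > 'X_(s 1) > ... > 'X_(s N.-1). *)
Definition ranking (mo : monomial_order) (s : 'S_N) : Prop :=
  forall i j : 'I_N, (i < j)%N ->
    mo U_(s j)%MM U_(s i)%MM /\ U_(s j)%MM <> U_(s i)%MM.

(* For u_i = 'X_(s i), the substitution below maps u_j to
   \sum_(i <= j) theta i j *: u_i. *)
Definition borel_fixed (mo : monomial_order) I : Prop :=
  forall (s : 'S_N) (theta : 'M[F]_N), ranking mo s ->
    theta \in unitmx -> (forall i j : 'I_N, (j < i)%N -> theta i j = 0) ->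
    forall f, I f ->
      I (linear_subst (\matrix_(a, b) theta (s^-1%g a) (s^-1%g b)) f).

Definition initial_monomial (mo : monomial_order) f (a : 'X_{1..N}) : Prop :=
  a \in msupp f /\ (forall b, b \in msupp f -> mo b a).

Definition initial_ideal (mo : monomial_order) I : set {mpoly F[N]} :=
  ideal_gen [set 'X_[a] | a in
               [set a | exists2 f, I f & initial_monomial mo f a]].

(* Zariski open subsets of GL_N. *)
Definition zariski_open (U : set 'M[F]_N) : Prop :=
  exists S : set {mpoly F[N * N]},
    U = [set A | A \in unitmx /\
                 exists2 P, S P & P.@[fun k => mxvec A 0 k] != 0].

Definition is_gin (mo : monomial_order) I J : Prop :=
  exists U : set 'M[F]_N, [/\ zariski_open U, U !=set0 &
    forall A, U A -> initial_ideal mo (linear_subst A @` I) = J].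

Definition generic_initial_ideals I : set (set {mpoly F[N]}) :=
  [set J | exists mo, is_gin mo I J].

(* The generic initial ideals of I, each one listed together with the ranking
   of the variables of a monomial order that produces it. *)
Definition ranked_generic_initial_ideals I : set ('S_N * set {mpoly F[N]}) :=
  [set sJ | exists2 mo, ranking mo sJ.1 & is_gin mo I sJ.2].

End Polynomials.

(* The variables x_i, y_i (i < l + m) and z_r (r < m); the first l indices in
   l + m belong to the copies of V_2, and z_r goes with the index l + r. *)
Section Variables.
Variables l m : nat.

Definition nvars : nat := (l + m) + ((l + m) + m).

Definition xv (i : 'I_(l + m)) : 'I_nvars := lshift _ i.
Definition yv (i : 'I_(l + m)) : 'I_nvars := rshift _ (lshift _ i).
Definition zv (r : 'I_m) : 'I_nvars := rshift _ (rshift _ r).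

Definition V2_vars (i : 'I_l) : 'I_2 -> 'I_nvars :=
  tnth [tuple xv (lshift m i); yv (lshift m i)].
Definition V3_vars (r : 'I_m) : 'I_3 -> 'I_nvars :=
  tnth [tuple xv (rshift l r); yv (rshift l r); zv r].

Definition L_gens (F : fieldType) (p : nat) : set {mpoly F[nvars]} :=
  [set f | [\/ exists i : 'I_(l + m), f = 'X_(xv i),
               exists i : 'I_l, f = 'X_(yv (lshift m i)) ^+ p,
               exists i j : 'I_m,
                 (i <= j)%N /\ f = 'X_(yv (rshift l i)) * 'X_(yv (rshift l j))
             | exists i : 'I_m, f = 'X_(zv i) ^+ p]].

End Variables.

Arguments L_gens l m F p : clear implicits.

(* Main.v *)
(* The Hilbert ideal I is built from the flag (x_i) < (x_i, y_i of the V_3's) <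
   (all variables) of spaces of linear forms: the linear forms of the first
   space, the products of two forms of the second, the p-th powers of all
   forms. In characteristic p it is therefore mapped into itself by every
   linear substitution preserving the flag; it is Borel fixed as soon as the
   x_i are ranked above the y_i of the V_3's, and these above the rest. For an
   order ranking the variables by s, let J be the copy of I, with renamed
   variables, that is Borel fixed. A generic substitution, composed with the
   renaming, factors as L U with L lower unitriangular and U upper triangular;
   U preserves J and L does not change initial monomials, so J is the generic
   initial ideal. *)
Require Import Defs.
From HB Require Import structures.
From mathcomp Require Import all_boot all_order all_algebra.
From mathcomp Require Import fingroup perm cyclic mxrepresentation.
From mathcomp Require Import classical_sets cardinality.
From mathcomp Require Import mpoly zify.

Set Implicit Arguments.
Unset Strict Implicit.
Unset Printing Implicit Defensive.

Import GRing.Theory.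

Local Open Scope classical_set_scope.
Local Open Scope card_scope.
Local Open Scope ring_scope.

(** * LU factorization without row exchanges *)

(* Nonzero when elimination on A without row exchanges meets no zero pivot; each
   Schur complement is cleared of its denominator, so that the result is a
   polynomial in the entries of A. *)
Fixpoint lu_pivots {R : comNzRingType} {n : nat} : 'M[R]_n -> R :=
  if n is n'.+1 then
    fun A : 'M[R]_(1 + n') =>
      A 0 0 * lu_pivots (A 0 0 *: drsubmx A - dlsubmx A *m ursubmx A)
  else fun=> 1.

Lemma lu_pivots1 (R : comNzRingType) n : lu_pivots (1%:M : 'M[R]_n) = 1.
Proof.
elim: n => [|n IHn] //=.
rewrite (@scalar_mx_block _ 1 n) block_mxKdr block_mxKdl block_mxKur.
by rewrite mulmx0 subr0 -scalar_mx_block !mxE scale1r mul1r.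
Qed.

(** Makes the pivots of a matrix of indeterminates one polynomial, whose value at each matrix is the
    [lu_pivots] of that matrix. *)
Lemma map_lu_pivots (R S : comNzRingType) (f : {rmorphism R -> S}) n
    (A : 'M[R]_n) :
  lu_pivots (map_mx f A) = f (lu_pivots A).
Proof.
elim: n A => [A|n IHn A] /=; first by rewrite rmorph1.
rewrite rmorphM -IHn map_mxB map_mxZ map_mxM.
by rewrite map_drsubmx map_dlsubmx map_ursubmx !mxE.
Qed.

Lemma is_trig_bordered_mx (R : pzSemiRingType) n (a : R) (v : 'cV_n) (L : 'M_n) :
  is_trig_mx L -> is_trig_mx (block_mx a%:M 0 v L : 'M_(1 + n)).
Proof. by move=> Ltrig; rewrite is_trig_block_mx // eqxx scalar_mx_is_trig. Qed.

Lemma is_trig_bordered_mxT (R : pzSemiRingType) n (a : R) (w : 'rV_n) (U : 'M_n) :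
  is_trig_mx U^T -> is_trig_mx (block_mx a%:M w 0 U : 'M_(1 + n))^T.
Proof.
move=> Utrig; rewrite tr_block_mx tr_scalar_mx trmx0.
exact: is_trig_bordered_mx.
Qed.

Lemma is_trig_mxZ (R : pzSemiRingType) n (a : R) (L : 'M_n) :
  is_trig_mx L -> is_trig_mx (a *: L).
Proof.
move=> /is_trig_mxP Ltrig; apply/is_trig_mxP => i j ij.
by rewrite mxE Ltrig // mulr0.
Qed.

(** Gaussian elimination, by induction on the size. The inverse [U'] is carried along so that its
    triangularity needs no separate argument. *)
Lemma lu_decomposition (F : fieldType) n (A : 'M[F]_n) : lu_pivots A != 0 ->
  exists L U U' : 'M[F]_n,
    [/\ A = L *m U, U *m U' = 1%:M, is_trig_mx L /\ (forall i, L i i = 1),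
        is_trig_mx U^T & is_trig_mx U'^T].
Proof.
elim: n A => [A _|n IHn A] /=.
  exists 1%:M, 1%:M, 1%:M.
  by split; try split; try (by apply/matrixP => -[]); try (by case);
    apply/is_trig_mxP => -[].
rewrite mulf_eq0 negb_or => /andP[a0 /IHn[L [U [U' [eA UU' [Ltrig L1] Utrig U'trig]]]]].
set a : F := _ 0 0 in a0 eA.
pose v := dlsubmx (A : 'M_(1 + n)); pose w := ursubmx (A : 'M_(1 + n)).
have ulA : ulsubmx (A : 'M_(1 + n)) = a%:M.
  by apply/matrixP => i j; rewrite !ord1 !mxE /= /a; congr (A _ _); exact/val_inj.
(* The inner [L *m U] is [a] times the Schur complement of the pivot, hence the factor [a^-1] on [U]
   and [a] on [U']. *)
exists (block_mx 1%:M 0 (a^-1 *: v) L), (block_mx a%:M w 0 (a^-1 *: U)),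
  (block_mx (a^-1)%:M (- w *m U') 0 (a *: U')); split.
- rewrite (@mulmx_block _ 1 n 1 n 1 n) !mul1mx !mul0mx !mulmx0 !addr0 -scalemxAr -eA.
  rewrite -scalemxAl mul_mx_scalar scalerA mulVf // scale1r -scalemxAl.
  rewrite -[LHS](@submxK _ 1 n 1 n) ulA scalerBr scalerA mulVf // scale1r.
  by rewrite [_ + (_ - _)]addrC subrK.
- rewrite (@mulmx_block _ 1 n 1 n 1 n) !mul0mx !mulmx0 !addr0 !add0r -scalar_mxM divff //.
  rewrite -scalemxAl -!scalemxAr scalerA mulVf // scale1r UU' mul_scalar_mx.
  by rewrite mulNmx scalerN addNr -scalar_mx_block.
- split; first exact: is_trig_bordered_mx.
  move=> i; have [j ->|j ->] := @split_ordP 1 n i.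
    by rewrite (@block_mxEul _ 1 n 1 n) mxE eqxx.
  by rewrite (@block_mxEdr _ 1 n 1 n).
- by apply: is_trig_bordered_mxT; rewrite linearZ; exact: is_trig_mxZ.
- by apply: is_trig_bordered_mxT; rewrite linearZ; exact: is_trig_mxZ.
Qed.

(** * Ideals generated by a set *)

Section IdealGen.
Variable R : comNzRingType.
Implicit Types S T : set R.

Lemma sub_ideal_gen S : S `<=` ideal_gen S.
Proof.
move=> f Sf; exists [:: (1, f)]; rewrite big_seq1 mul1r; split=> // c.
by rewrite inE => /eqP ->.
Qed.

Lemma ideal_gen0 S : ideal_gen S 0.
Proof. by exists [::]; rewrite big_nil. Qed.

Lemma ideal_genD S f h : ideal_gen S f -> ideal_gen S h -> ideal_gen S (f + h).
Proof.
move=> [cs [Scs ->]] [ds [Sds ->]]; exists (cs ++ ds).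
rewrite big_cat; split=> // c.
by rewrite mem_cat => /orP[/Scs|/Sds].
Qed.

Lemma ideal_genM S f h : ideal_gen S h -> ideal_gen S (f * h).
Proof.
move=> [cs [Scs ->]]; exists [seq (f * c.1, c.2) | c <- cs].
split=> [c /mapP[d /Scs Sd ->] //|].
by rewrite big_map mulr_sumr; apply: eq_bigr => c _; rewrite mulrA.
Qed.

Lemma ideal_gen_sum S (I : eqType) (s : seq I) (f : I -> R) :
  (forall i, i \in s -> ideal_gen S (f i)) -> ideal_gen S (\sum_(i <- s) f i).
Proof.
move=> Sf; rewrite big_seq; elim/big_ind: _ => [||i /Sf //].
  exact: ideal_gen0.
exact: ideal_genD.
Qed.

Lemma ideal_gen_ind S (J : set R) : J 0 ->
    (forall f h, J f -> J h -> J (f + h)) -> (forall f h, J h -> J (f * h)) ->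
  S `<=` J -> ideal_gen S `<=` J.
Proof.
move=> J0 JD JM SJ _ [cs [Scs ->]]; rewrite big_seq.
by elim/big_ind: _ => // c /Scs Sc; apply/JM/SJ.
Qed.

End IdealGen.

Lemma rmorph_ideal_gen (R R' : comNzRingType) (phi : {rmorphism R -> R'})
    (S : set R) (T : set R') :
  (forall f, S f -> ideal_gen T (phi f)) ->
  forall f, ideal_gen S f -> ideal_gen T (phi f).
Proof.
move=> ST; apply: (@ideal_gen_ind _ S (phi @^-1` ideal_gen T)).
- by rewrite /preimage /= rmorph0; exact: ideal_gen0.
- by move=> f h; rewrite /preimage /= rmorphD; exact: ideal_genD.
- by move=> f h; rewrite /preimage /= rmorphM; exact: ideal_genM.
- exact: ST.
Qed.

(** The right inverse [psi] makes [phi] surjective, which closes the image under multiplication by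
    arbitrary elements. *)
Lemma image_ideal_gen (R R' : comNzRingType) (phi : {rmorphism R -> R'})
    (psi : R' -> R) (S : set R) :
  cancel psi phi -> phi @` ideal_gen S = ideal_gen (phi @` S).
Proof.
move=> psiK; apply/seteqP; split.
  move=> _ [f Sf <-]; move: f Sf; apply: rmorph_ideal_gen => f Sf.
  by apply: sub_ideal_gen; exists f.
apply: ideal_gen_ind.
- by exists 0; [exact: ideal_gen0|rewrite rmorph0].
- move=> _ _ [f Sf <-] [h Sh <-]; exists (f + h); first exact: ideal_genD.
  by rewrite rmorphD.
- move=> f _ [h Sh <-]; exists (psi f * h); first exact: ideal_genM.
  by rewrite rmorphM psiK.
- by move=> _ [f Sf <-]; exists f => //; exact: sub_ideal_gen.
Qed.

(** * Monomial ideals and supports *)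

Section MonomialIdeals.
Variables (F : fieldType) (N : nat).
Implicit Types (f h : {mpoly F[N]}) (a b : 'X_{1..N}) (P Q : set 'X_{1..N}).

Definition supported P f : Prop := forall a, a \in msupp f -> P a.

Lemma supported0 P : supported P 0.
Proof. by move=> a; rewrite msupp0. Qed.

Lemma supportedD P f h : supported P f -> supported P h -> supported P (f + h).
Proof. by move=> Pf Ph a /msuppD_le; rewrite mem_cat => /orP[/Pf|/Ph]. Qed.

Lemma supportedZ P c f : supported P f -> supported P (c *: f).
Proof. by move=> Pf a /msuppZ_le /Pf. Qed.

Lemma supported_sum P (I : eqType) (s : seq I) (f : I -> {mpoly F[N]}) :
  (forall i, i \in s -> supported P (f i)) -> supported P (\sum_(i <- s) f i).
Proof.
move=> Pf; rewrite big_seq; elim/big_ind: _ => [||i /Pf //].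
  exact: supported0.
exact: supportedD.
Qed.

Lemma supportedM P Q P' f h :
  (forall a b, P a -> Q b -> P' (a + b)%MM) ->
  supported P f -> supported Q h -> supported P' (f * h).
Proof.
by move=> PQ Pf Qh _ /msuppM_le /allpairsP[[a b] [/Pf Pa /Qh Qb ->]]; exact: PQ.
Qed.

Lemma supportedX P a : P a -> supported P 'X_[a].
Proof. by move=> Pa b /mem_msuppXP <-. Qed.

Lemma supported_sub P Q f : P `<=` Q -> supported P f -> supported Q f.
Proof. by move=> PQ Pf a /Pf /PQ. Qed.

Definition multiples P : set 'X_{1..N} := [set a | exists2 b, P b & (b <= a)%MM].

Lemma multiplesD P a b : multiples P b -> multiples P (a + b)%MM.
Proof.
by move=> [c Pc cb]; exists c => //; exact: lepm_trans cb (lem_addl _ _).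
Qed.

Definition monomial_ideal P : set {mpoly F[N]} :=
  ideal_gen [set 'X_[a] | a in P].

Lemma monomial_ideal_multiples P a : multiples P a -> monomial_ideal P 'X_[a].
Proof.
move=> [b Pb ba]; rewrite -(submK ba) mpolyXD; apply: ideal_genM.
by apply: sub_ideal_gen; exists b.
Qed.

Lemma monomial_idealP P f : monomial_ideal P f <-> supported (multiples P) f.
Proof.
split.
  move: f; apply: ideal_gen_ind; first exact: supported0.
  - exact: supportedD.
  - move=> f h; apply: (@supportedM setT) => // a b _; exact: multiplesD.
  - by move=> _ [a Pa <-]; apply: supportedX; exists a => //; exact: lepm_refl.
move=> Pf; rewrite [f]mpolyE; apply: ideal_gen_sum => a /Pf Pa.
by rewrite -mul_mpolyC; apply/ideal_genM/monomial_ideal_multiples.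
Qed.

Lemma monomial_idealX P a :
  monomial_ideal P ('X_[a] : {mpoly F[N]}) <-> multiples P a.
Proof.
split; last exact: monomial_ideal_multiples.
by move=> /monomial_idealP; apply; exact/mem_msuppXP.
Qed.

End MonomialIdeals.

(** * Composition of linear substitutions *)

Section LinearSubst.
Variables (F : fieldType) (N : nat).
Implicit Types (A B : 'M[F]_N) (f h : {mpoly F[N]}).

HB.instance Definition _ A := GRing.LRMorphism.copy (linear_subst A)
  (comp_mpoly [tuple \sum_i A i j *: 'X_i | j < N] : {mpoly F[N]} -> {mpoly F[N]}).

Lemma linear_substU A j : linear_subst A 'X_j = \sum_i A i j *: 'X_i.
Proof. by rewrite /linear_subst comp_mpolyXU -tnth_nth tnth_mktuple. Qed.

Lemma linear_substX A a :
  linear_subst A 'X_[a] = \prod_i (\sum_k A k i *: 'X_k) ^+ a i.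
Proof.
rewrite /linear_subst comp_mpolyX; apply: eq_bigr => i _.
by rewrite tnth_mktuple.
Qed.

Lemma eq_lrmorphism_mpoly
    (phi psi : {lrmorphism {mpoly F[N]} -> {mpoly F[N]}}) :
  (forall i, phi 'X_i = psi 'X_i) -> phi =1 psi.
Proof.
move=> eqX f; rewrite [f]mpolyE !linear_sum; apply: eq_bigr => a _.
rewrite !linearZ /= mpolyXE_id !rmorph_prod; congr (_ *: _).
by apply: eq_bigr => i _; rewrite !rmorphXn /= eqX.
Qed.

(** Both sides are algebra maps in [f], so it suffices to compare them on the variables, where this
    is the formula for a matrix product. *)
Lemma linear_substM A B f :
  linear_subst (A *m B) f = linear_subst A (linear_subst B f).
Proof.
rewrite -[RHS]/((linear_subst A \o linear_subst B) f).
move: f; apply: eq_lrmorphism_mpoly => // j /=.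
rewrite !linear_substU linear_sum; under eq_bigr do rewrite mxE scaler_suml.
rewrite exchange_big; apply: eq_bigr => k _.
rewrite linearZ /= linear_substU scaler_sumr; apply: eq_bigr => i _.
by rewrite scalerA mulrC.
Qed.

Lemma linear_subst1 f : linear_subst 1%:M f = f.
Proof.
rewrite -[RHS]/(idfun f); move: f; apply: eq_lrmorphism_mpoly => // j /=.
rewrite linear_substU (bigD1 j) //= mxE eqxx scale1r big1 ?addr0 // => i ij.
by rewrite mxE (negPf ij) scale0r.
Qed.

End LinearSubst.

(** * Initial monomials under lower unitriangular substitutions *)

Section InitialIdeals.
Variables (F : fieldType) (N : nat) (mo : monomial_order N).
Implicit Types (f h : {mpoly F[N]}) (a b c : 'X_{1..N}).

Definition mo_lt a b : Prop := mo a b /\ a <> b.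

Lemma mo_refl a : mo a a.
Proof. by have := mo_total mo a a; rewrite orbb. Qed.

Lemma mo_leD2 a b c d : mo a b -> mo c d -> mo (a + c)%MM (b + d)%MM.
Proof.
move=> ab cd; apply: (mo_trans (y := (b + c)%MM)); first exact: mo_leD.
by rewrite ![(b + _)%MM]addmC; exact: mo_leD.
Qed.

Lemma mo_lt_leD a b c d : mo_lt a b -> mo c d -> mo_lt (a + c)%MM (b + d)%MM.
Proof.
move=> [ab neq_ab] cd; split=> [|e]; first exact: mo_leD2.
(* As [a + c <= b + c <= b + d], equality of the ends forces [a + c = b + c]. *)
apply: neq_ab; apply: (@addIm _ c); apply: (@mo_anti _ mo).
by rewrite mo_leD //= e mo_leD2 // mo_refl.
Qed.

Lemma mo_le_ltD a b c d : mo a b -> mo_lt c d -> mo_lt (a + c)%MM (b + d)%MM.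
Proof. by move=> ab cd; rewrite addmC [(b + d)%MM]addmC; exact: mo_lt_leD. Qed.

Lemma initial_monomial_exists f : f != 0 -> exists a, initial_monomial mo f a.
Proof.
rewrite -msupp_eq0 /initial_monomial; elim: (msupp f) => // b s IHs _.
have [->|/IHs[a [sa amax]]] := eqVneq s [::].
  by exists b; split; rewrite ?mem_head // => c; rewrite inE => /eqP ->; exact: mo_refl.
have /orP[ab|ba] := mo_total mo a b.
  exists b; split; rewrite ?mem_head // => c; rewrite inE.
  by move=> /predU1P[->|/amax ca]; [exact: mo_refl|exact: mo_trans ca ab].
exists a; split; first by rewrite inE sa orbT.
by move=> c; rewrite inE => /predU1P[->|/amax].
Qed.

Lemma initial_monomial_uniq f a b :
  initial_monomial mo f a -> initial_monomial mo f b -> a = b.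
Proof.
by move=> [fa amax] [fb bmax]; apply: (@mo_anti _ mo); rewrite amax ?bmax.
Qed.

(** Says that [f] is monic with initial monomial [a], in a form that passes to products. *)
Definition tail_below a f : Prop := supported (mo_lt^~ a) (f - 'X_[a]).

Lemma tail_belowM a b f h :
  tail_below a f -> tail_below b h -> tail_below (a + b)%MM (f * h).
Proof.
move=> fa hb; rewrite /tail_below mpolyXD.
have -> : f * h - 'X_[a] * 'X_[b] = (f - 'X_[a]) * h + 'X_[a] * (h - 'X_[b]).
  by rewrite mulrBl mulrBr addrA subrK.
apply: supportedD.
  apply: (@supportedM _ _ (mo_lt^~ a) (mo^~ b)) fa _.
    by move=> c d; exact: mo_lt_leD.
  rewrite -[h](subrK 'X_[b]); apply: supportedD.
    by apply: supported_sub hb => c -[].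
  by apply: supportedX; exact: mo_refl.
apply: (@supportedM _ _ (mo^~ a) (mo_lt^~ b)) hb.
  by move=> c d; exact: mo_le_ltD.
by apply: supportedX; exact: mo_refl.
Qed.

Lemma tail_below1 : tail_below 0%MM 1.
Proof. by rewrite /tail_below mpolyX0 subrr; exact: supported0. Qed.

Lemma tail_belowXn a f k : tail_below a f -> tail_below (a *+ k)%MM (f ^+ k).
Proof.
move=> fa; elim: k => [|k IHk]; first by rewrite mulm0n expr0; exact: tail_below1.
by rewrite mulmS exprS; exact: tail_belowM.
Qed.

Section LowerUnitriangular.
Variable L : 'M[F]_N.
Hypothesis L1 : forall i, L i i = 1.
Hypothesis Llow : forall i j, i != j -> L i j != 0 -> mo_lt U_(i)%MM U_(j)%MM.

(** Each variable goes to itself plus smaller variables, and [tail_below] is multiplicative. *)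
Lemma tail_below_lower_subst a : tail_below a (linear_subst L 'X_[a]).
Proof.
rewrite linear_substX [X in tail_below X _]multinomUE_id.
apply: (big_ind2 tail_below); first exact: tail_below1.
  by move=> a1 f1 a2 f2; exact: tail_belowM.
move=> j _; apply: tail_belowXn; rewrite /tail_below (bigD1 j) //= L1 scale1r.
rewrite [X in supported _ X]addrC addKr; elim/big_ind: _ => [||i ij]; first exact: supported0.
  exact: supportedD.
have [->|Lij] := eqVneq (L i j) 0; first by rewrite scale0r; exact: supported0.
by apply: supportedZ; apply: supportedX; exact: Llow.
Qed.

(** Each monomial [b <= a] of [f] changes only by monomials below [b], hence below [a]; so the
    coefficient of [a] is untouched and nothing above it appears. *)
Lemma initial_monomial_lower_subst f a :
  initial_monomial mo f a -> initial_monomial mo (linear_subst L f) a.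
Proof.
move=> [fa amax].
have tl : supported (mo_lt^~ a) (linear_subst L f - f).
  rewrite [in linear_subst L f](mpolyE f) linear_sum [X in _ - X](mpolyE f) -sumrB.
  apply: supported_sum => b /amax ba; rewrite linearZ -scalerBr.
  apply: supportedZ; apply: (@supported_sub _ _ (mo_lt^~ b)); last exact: tail_below_lower_subst.
  move=> c [cb neq_cb].
  split=> [|e]; first exact: mo_trans cb ba.
  by apply: neq_cb; apply: (@mo_anti _ mo); rewrite cb e.
rewrite -[linear_subst L f](subrK f); split=> [|b].
  rewrite mcoeff_msupp mcoeffD [X in X + _]memN_msupp_eq0 ?add0r -?mcoeff_msupp //.
  by apply/negP => /tl[].
by move=> /msuppD_le; rewrite mem_cat => /orP[/tl[]|/amax].
Qed.

(** A monomial ideal contains the initial monomials of its elements, and the substitution keeps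
    these; conversely, each monomial of the ideal is the initial monomial of its own image. *)
Lemma initial_ideal_lower_subst (P : set 'X_{1..N}) :
  initial_ideal mo (linear_subst L @` monomial_ideal P) = monomial_ideal P :> set {mpoly F[N]}.
Proof.
apply/seteqP; split.
  apply: ideal_gen_ind; first exact: ideal_gen0.
  - exact: ideal_genD.
  - exact: ideal_genM.
  move=> _ [a [_ [f Pf <-] ina] <-].
  have f0 : f != 0.
    by apply: contraTneq ina.1 => ->; rewrite raddf0 msupp0.
  have [b inb] := initial_monomial_exists f0.
  rewrite (initial_monomial_uniq ina (initial_monomial_lower_subst inb)).
  by apply/monomial_ideal_multiples/(monomial_idealP P f).1 => //; case: inb.
move=> f /monomial_idealP Pf; rewrite [f]mpolyE; apply: ideal_gen_sum => a /Pf Pa.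
rewrite -mul_mpolyC; apply/ideal_genM/sub_ideal_gen; exists a => //.
exists (linear_subst L 'X_[a]).
  by exists 'X_[a] => //; exact: monomial_ideal_multiples.
apply: initial_monomial_lower_subst; split=> [|b]; first exact/mem_msuppXP.
by move=> /mem_msuppXP ->; exact: mo_refl.
Qed.

End LowerUnitriangular.
End InitialIdeals.

(** * Ideals attached to a flag of variables *)

Section LevelIdeals.
Variables (F : fieldType) (N p : nat).
Implicit Types (lev : 'I_N -> nat) (A B : 'M[F]_N) (s : 'S_N).

(* The level of a variable is its step in the flag: 0, 1, or more. *)
Definition level_gens lev : set 'X_{1..N} :=
  [set a | [\/ exists2 i, lev i = 0%N & a = U_(i)%MM,
               exists i j, [/\ lev i = 1%N, lev j = 1%N & a = (U_(i) + U_(j))%MM]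
             | exists2 i, (1 < lev i)%N & a = (U_(i) *+ p)%MM]].

Definition level_ideal lev : set {mpoly F[N]} := monomial_ideal (level_gens lev).

Lemma level_idealX lev i : lev i = 0%N -> level_ideal lev 'X_i.
Proof. by move=> i0; apply: sub_ideal_gen; exists U_(i)%MM => //; apply: Or31; exists i. Qed.

Lemma level_idealXM lev i j :
  (lev i <= 1)%N -> (lev j <= 1)%N -> level_ideal lev ('X_i * 'X_j).
Proof.
have le1 n : (n <= 1)%N -> n = 0%N \/ n = 1%N.
  by case: n => [|[]] //; [left|right].
move=> /le1[i0|i1]; first by rewrite mulrC => _; exact/ideal_genM/level_idealX.
move=> /le1[j0|j1]; first exact/ideal_genM/level_idealX.
apply: sub_ideal_gen; exists (U_(i) + U_(j))%MM; last exact: mpolyXD.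
by apply: Or32; exists i, j.
Qed.

Lemma level_idealXp lev i : (1 < p)%N -> level_ideal lev ('X_i ^+ p).
Proof.
move=> p_gt1; have [i1|i1] := leqP (lev i) 1.
  case: p p_gt1 => [|[|n]] // _; rewrite exprSr exprSr -mulrA.
  exact/ideal_genM/level_idealXM.
apply: sub_ideal_gen; exists (U_(i) *+ p)%MM; last by rewrite mpolyXn.
by apply: Or33; exists i.
Qed.

(** By hypothesis ['X_j] goes to a linear form in variables of level at most [lev j], so the image
    of each kind of generator can be expanded. *)
Lemma level_ideal_stable lev A : p \in [pchar F] ->
    (forall i j, (lev j < lev i)%N -> A i j = 0) ->
  forall f, level_ideal lev f -> level_ideal lev (linear_subst A f).
Proof.
move=> chFp A0; have p_gt1 := prime_gt1 (pcharf_prime chFp).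
(* [Q] is a downward closed condition on levels, used as level at most 0 and level at most 1. *)
have supp_col j (Q : pred nat) : Q (lev j) ->
    (forall n k, (n <= k)%N -> Q k -> Q n) ->
  linear_subst A 'X_j = \sum_(i | Q (lev i)) A i j *: 'X_i.
  move=> Qj Qle; rewrite linear_substU (bigID (fun i => Q (lev i))) /=.
  rewrite [X in _ + X]big1 ?addr0 // => i Qi; rewrite A0 ?scale0r // ltnNge.
  by apply: contra Qi => /Qle; exact.
apply: rmorph_ideal_gen => _ [_ [[j j0 ->]|[i [j [i1 j1 ->]]]|[j _ ->]] <-].
- rewrite /= (supp_col j (leq^~ 0)) ?j0 //; last by move=> n k; exact: leq_trans.
  rewrite -big_filter; apply: ideal_gen_sum => i; rewrite mem_filter leqn0 => /andP[/eqP i0 _].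
  by rewrite -mul_mpolyC; exact/ideal_genM/level_idealX.
- rewrite mpolyXD rmorphM /=.
  rewrite !(supp_col _ (leq^~ 1)) ?i1 ?j1 //; try by move=> n k; exact: leq_trans.
  rewrite mulr_suml -big_filter; apply: ideal_gen_sum => k.
  rewrite mem_filter => /andP[k1 _].
  rewrite mulr_sumr -big_filter; apply: ideal_gen_sum => k'.
  rewrite mem_filter => /andP[k'1 _].
  rewrite -scalerAl -scalerAr -!mul_mpolyC.
  by do 2 apply: ideal_genM; exact: level_idealXM.
- rewrite -mpolyXn rmorphXn /= linear_substU.
  (* Frobenius is additive in characteristic [p], so the [p]-th power of a linear form is a
     combination of [p]-th powers of variables. *)
  have chp : p \in [pchar {mpoly F[N]}] by exact: (rmorph_pchar (@mpolyC N F)).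
  rewrite -(pFrobenius_autE chp) rmorph_sum; apply: ideal_gen_sum => i _.
  rewrite /= pFrobenius_autE exprZn -mul_mpolyC.
  by apply: ideal_genM; apply: level_idealXp.
Qed.

Lemma msym_level_gens lev s a : level_gens lev a ->
  level_gens (lev \o s^-1%g) [multinom a (s^-1%g i) | i < N].
Proof.
have sU i : [multinom U_(i)%MM (s^-1%g k) | k < N] = U_(s i)%MM :> 'X_{1..N}.
  by apply/mnmP => k; rewrite mnmE !mnm1E -(inj_eq (@perm_inj _ s)) permKV.
move=> [[i i0 ->]|[i [j [i1 j1 ->]]]|[i i2 ->]].
- by apply: Or31; exists (s i); rewrite ?sU //= permK.
- apply: Or32; exists (s i), (s j); rewrite /= !permK -!sU; split=> //.
  by apply/mnmP => k; rewrite mnmDE !mnmE.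
- apply: Or33; exists (s i); rewrite /= ?permK // -sU.
  by apply/mnmP => k; rewrite mnmE !mulmnE mnmE.
Qed.

Lemma msymK s : cancel (msym s^-1%g) (msym s : {mpoly F[N]} -> {mpoly F[N]}).
Proof.
move=> f; apply/mpolyP => a; rewrite !mcoeff_sym; congr (_@__).
by apply/mnmP => i; rewrite !mnmE permKV.
Qed.

Lemma msym_level_ideal lev s :
  msym s @` level_ideal lev = level_ideal (lev \o s^-1%g).
Proof.
rewrite (image_ideal_gen _ (msymK s)); congr ideal_gen; apply/seteqP; split.
  move=> _ [_ [a lev_a <-] <-]; rewrite /= msymX.
  by exists [multinom a (s^-1%g i) | i < N] => //; exact: msym_level_gens.
move=> _ [a lev_a <-]; exists (msym s^-1%g 'X_[a]); last exact: msymK.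
rewrite msymX; eexists; last by [].
have := @msym_level_gens _ s^-1%g _ lev_a; congr level_gens.
by apply/boolp.funext => i /=; rewrite invgK permK.
Qed.

End LevelIdeals.

(** * Intersection of Zariski open sets and uniqueness of the generic initial ideal *)

Section ZariskiOpen.
Variables (F : fieldType) (N : nat).
Hypothesis F_infinite : infinite_set [set: F].

Lemma infinite_nonroot (q : {poly F}) : q != 0 -> exists t, q.[t] != 0.
Proof.
move=> q0; apply: boolp.contrapT => rootq.
have [B _ leqB] := infinite_set_fset (size q) F_infinite.
have := max_poly_roots q0 _ (finmap.fset_uniq B); rewrite ltnNge leqB => /(_ _)/negP; apply => //.
by apply/allP => t _; rewrite /root; apply: contra_notT rootq => qt; exists t.
Qed.

Lemma horner_mmap (h : 'I_(N * N) -> {poly F}) (P : {mpoly F[N * N]}) t :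
  (mmap polyC h P).[t] = P.@[fun k => (h k).[t]].
Proof.
rewrite /mmap horner_sum mevalE; apply: eq_bigr => a _.
rewrite hornerM hornerC /mmap1 horner_prod; congr (_ * _).
by apply: eq_bigr => k _; rewrite horner_exp.
Qed.

Lemma zariski_open_meet (U1 U2 : set 'M[F]_N) :
    zariski_open U1 -> U1 !=set0 -> zariski_open U2 -> U2 !=set0 ->
  exists2 A, U1 A & U2 A.
Proof.
move=> [S1 ->] [A1 [A1unit [P1 SP1 P1A1]]] [S2 ->] [A2 [A2unit [P2 SP2 P2A2]]].
(* Restricted to the line through A1 and A2, the two opens become complements
   of the roots of nonzero univariate polynomials. *)
pose line : 'M[{poly F}]_N := \matrix_(i, j) ((A1 i j)%:P + 'X * (A2 i j - A1 i j)%:P).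
pose at_ t : 'M[F]_N := map_mx (horner_eval t) line.
have at0 : at_ 0 = A1.
  by apply/matrixP => i j; rewrite !mxE horner_evalE hornerD hornerM hornerX !hornerC mul0r addr0.
have at1 : at_ 1 = A2.
  by apply/matrixP => i j; rewrite !mxE horner_evalE hornerD hornerM hornerX !hornerC mul1r addrC subrK.
pose on_line P := mmap polyC (fun k => mxvec line 0 k) P.
have on_lineE P t : (on_line P).[t] = P.@[fun k => mxvec (at_ t) 0 k].
  by rewrite horner_mmap; apply: meval_eq => k; rewrite /at_ -map_mxvec [RHS]mxE.
have nz_of (q : {poly F}) t : q.[t] != 0 -> q != 0.
  by apply: contraNneq => ->; rewrite horner0.
have detE t : (\det line).[t] = \det (at_ t) by rewrite -horner_evalE -det_map_mx.
(* The factor [\det line] keeps the chosen point of the line invertible. *)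
have [t] : exists t, (on_line P1 * on_line P2 * \det line).[t] != 0.
  apply: infinite_nonroot; rewrite !mulf_neq0 //.
  - by apply: (nz_of _ 0); rewrite on_lineE at0.
  - by apply: (nz_of _ 1); rewrite on_lineE at1.
  - by apply: (nz_of _ 0); rewrite detE at0 -unitfE.
rewrite !hornerM !mulf_eq0 !negb_or !on_lineE detE.
move=> /andP[/andP[nz1 nz2]]; rewrite -unitfE -unitmxE => at_unit.
by exists (at_ t); split=> //; [exists P1|exists P2].
Qed.

(** Both ideals are the initial ideal at a common point of the two open sets. *)
Lemma is_gin_uniq (mo : monomial_order N) (I J J' : set {mpoly F[N]}) :
  is_gin mo I J -> is_gin mo I J' -> J = J'.
Proof.
move=> [U [Uopen U0 UJ]] [U' [U'open U'0 U'J']].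
have [A UA U'A] := zariski_open_meet Uopen U0 U'open U'0.
by rewrite -(UJ A UA) -(U'J' A U'A).
Qed.

End ZariskiOpen.

(** * Rankings of the variables and counting of permutations *)

Lemma sorting_perm N (le : rel 'I_N) : total le -> transitive le ->
  exists s : 'S_N, forall i j : 'I_N, (i < j)%N -> le (s i) (s j).
Proof.
move=> le_total le_trans; pose t := sort le (enum 'I_N).
have size_t : size t == N by rewrite size_sort size_enum_ord.
pose f i := tnth (Tuple size_t) i.
have f_inj : injective f.
  by apply/tuple_uniqP; rewrite /= sort_uniq enum_uniq.
exists (perm f_inj) => i j ij; rewrite !permE /f !(tnth_nth (f i)) /=.
apply: (sorted_ltn_nth le_trans) => //; rewrite ?inE ?(eqP size_t) //.
exact: sort_sorted.
Qed.

Section Rankings.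
Variable N : nat.
Implicit Types (s : 'S_N) (mo : monomial_order N).

Lemma ranking_exists mo : exists s, ranking mo s.
Proof.
have [||s s_sorted] := @sorting_perm N (fun i j => mo U_(j)%MM U_(i)%MM).
- by move=> i j; exact: mo_total.
- by move=> j i k ij jk; exact: mo_trans jk ij.
exists s => i j ij; split; first exact: s_sorted.
move=> /mnmP/(_ (s j)); rewrite !mnm1E eqxx (inj_eq perm_inj).
by case: eqVneq ij => // ->; rewrite ltnn.
Qed.

Lemma ranking_le mo s i j : ranking mo s -> mo U_(s j)%MM U_(s i)%MM -> (i <= j)%N.
Proof.
move=> ranks ji; rewrite leqNgt; apply/negP => /ranks[ij []].
by apply: (@mo_anti _ mo); rewrite ij.
Qed.

(** The degree-lexicographic order on exponent vectors, transported along the renaming of the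
    variables by [s]. *)
Lemma monomial_order_of_ranking s : exists mo, ranking mo s.
Proof.
pose rd (a : 'X_{1..N}) : 'X_{1..N} := [multinom a (s i) | i < N].
have rd_inj : injective rd.
  move=> a b /mnmP ab; apply/mnmP => i.
  by have := ab (s^-1%g i); rewrite !mnmE permKV.
have rdD a b : rd (a + b)%MM = (rd a + rd b)%MM.
  by apply/mnmP => i; rewrite mnmDE !mnmE.
pose le : rel 'X_{1..N} := fun a b => (rd a <= rd b)%O.
have le_anti : antisymmetric le.
  by move=> a b /Order.POrderTheory.le_anti/rd_inj.
have le_trans : transitive le by move=> b a c; exact: Order.POrderTheory.le_trans.
have le_total : total le by move=> a b; exact: Order.TotalTheory.le_total.
have le_0 a : le 0%MM a.
  have -> : le 0%MM a = (0%MM <= rd a)%O; last exact: le0m.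
  by congr (_ <= _)%O; apply/mnmP => i; rewrite !mnmE.
have le_D a b c : le a b -> le (a + c)%MM (b + c)%MM.
  by rewrite /le !rdD lemc_add2l.
exists (MonomialOrder le_anti le_trans le_total le_0 le_D) => i j ij.
have rdU k : rd U_(s k)%MM = U_(k)%MM.
  by apply/mnmP => k'; rewrite !mnmE (inj_eq perm_inj).
have : (U_(j)%MM < U_(i)%MM :> 'X_{1..N})%O.
  apply/ltmcP; first by rewrite !mdeg1.
  exists i => [k ki|]; rewrite !mnm1E ?eqxx.
    have ltj := ltn_trans ki ij.
    by rewrite !eqE /= !gtn_eqF.
  by rewrite eqE /= gtn_eqF.
rewrite Order.POrderTheory.lt_neqAle => /andP[neq_ji le_ji]; split=> /=.
  by rewrite /le !rdU.
by move=> /(congr1 rd); rewrite !rdU => /eqP; rewrite (negPf neq_ji).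
Qed.

End Rankings.

Lemma card_eq_injective_perm N T (f : 'S_N -> T) (A : set T) :
  injective f -> A = f @` setT -> A #= `I_(N`!).
Proof.
move=> f_inj ->.
have -> : N`! = #|{: 'S_N}| by rewrite -card_Sn; apply: eq_card => s; rewrite !inE.
apply: card_eq_trans (inj_card_eq (in2W f_inj)) _.
rewrite card_eq_sym; apply: card_eq_trans card_II _.
have -> : [set: 'S_N] = enum_val @` [set: 'I_#|{: 'S_N}|].
  by apply/seteqP; split=> // s _; exists (enum_rank s) => //; rewrite enum_rankK.
by rewrite card_eq_sym; apply: inj_card_eq => i j _ _ /enum_val_inj.
Qed.

(** * Borel fixedness and generic initial ideals of level ideals *)

Section GenericInitialIdeals.
Variables (F : fieldType) (N p : nat).
Hypothesis chFp : p \in [pchar F].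
Implicit Types (lev : 'I_N -> nat) (s c : 'S_N) (mo : monomial_order N).

(** The matrix of the substitution that [A] describes in the variables ['X_(s 0)], ['X_(s 1)], ...,
    as in [borel_fixed]. *)
Definition relabel_mx s (A : 'M[F]_N) : 'M[F]_N :=
  \matrix_(i, j) A (s^-1%g i) (s^-1%g j).

Lemma relabel_mxM s A B : relabel_mx s (A *m B) = relabel_mx s A *m relabel_mx s B.
Proof.
apply/matrixP => i j; rewrite !mxE (reindex_inj (@perm_inj _ s^-1%g)).
by apply: eq_bigr => k _; rewrite !mxE.
Qed.

Lemma relabel_mx1 s : relabel_mx s 1%:M = 1%:M.
Proof. by apply/matrixP => i j; rewrite !mxE (inj_eq perm_inj). Qed.

Lemma linear_subst_perm s (f : {mpoly F[N]}) :
  linear_subst (\matrix_(i, j) (i == s j)%:R) f = msym s f.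
Proof.
have eqX j : linear_subst (\matrix_(i, j) (i == s j)%:R : 'M[F]_N) 'X_j = 'X_(s j).
  rewrite linear_substU (bigD1 (s j)) //= mxE eqxx scale1r big1 ?addr0 // => i.
  by rewrite mxE => /negPf ->; rewrite scale0r.
rewrite [f]mpolyE !raddf_sum; apply: eq_bigr => a _ /=.
rewrite linearZ /= -!mul_mpolyC rmorphM /=; congr (_ * _).
  by rewrite /msym mmapC.
rewrite mpolyXE_id !rmorph_prod; apply: eq_bigr => j _.
rewrite !rmorphXn /= eqX; congr (_ ^+ _).
by rewrite /msym mmapX mmap1U.
Qed.

(** [c] lists the variables by increasing level, so triangularity in that order kills every
    coefficient leading from a level to a higher one. *)
Lemma level_ideal_upper lev c (U : 'M[F]_N) :
    (forall i j : 'I_N, (i < j)%N -> (lev (c i) <= lev (c j))%N) ->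
    (forall i j : 'I_N, (j < i)%N -> U i j = 0) ->
  forall f, level_ideal p lev f -> level_ideal p lev (linear_subst (relabel_mx c U) f).
Proof.
move=> lev_c U0; apply: level_ideal_stable => // i j lt_ji; rewrite mxE U0 //.
rewrite ltnNge leq_eqVlt; apply: contraTN lt_ji => /predU1P[/val_inj/perm_inj->|ij].
  by rewrite ltnn.
by rewrite -leqNgt -(permKV c i) -(permKV c j) lev_c.
Qed.

Lemma level_ideal_borel_fixed lev c mo :
    (forall i j : 'I_N, (i < j)%N -> (lev (c i) <= lev (c j))%N) ->
  ranking mo c -> borel_fixed mo (level_ideal p lev : set {mpoly F[N]}).
Proof.
move=> lev_c rankc s theta ranks _ theta0; apply: level_ideal_upper => // i j ij.
(* As [c] and [s] both rank the variables for [mo], [s] too lists them by increasing level. *)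
have [ji ne_ji] := ranks i j ij.
rewrite -(permKV c (s i)) -(permKV c (s j)) in ji ne_ji *.
have := ranking_le rankc ji; rewrite leq_eqVlt => /predU1P[/val_inj->|/lev_c //].
by rewrite leqnn.
Qed.

Lemma is_gin_level_ideal lev c s mo :
    (forall i j : 'I_N, (i < j)%N -> (lev (c i) <= lev (c j))%N) ->
    ranking mo s ->
  is_gin mo (level_ideal p lev : set {mpoly F[N]}) (level_ideal p (lev \o c \o s^-1%g)).
Proof.
move=> lev_c ranks.
(* [pull] lists the rows in the order [s] and the columns in the order [c]; nonvanishing pivots of
   the pulled matrix define the open set. *)
pose pull (R : nzRingType) (A : 'M[R]_N) : 'M[R]_N := \matrix_(i, j) A (s i) (c j).
pose X : 'M[{mpoly F[N * N]}]_N := \matrix_(i, j) 'X_(mxvec_index i j).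
have pullE A : (lu_pivots (pull _ X)).@[fun k => mxvec A 0 k] = lu_pivots (pull _ A).
  rewrite -[LHS]/(meval _ _) -map_lu_pivots; congr lu_pivots; apply/matrixP => i j.
  by rewrite !mxE /= mevalXU mxvecE.
exists [set A | A \in unitmx /\ exists2 P, [set lu_pivots (pull _ X)] P &
                 P.@[fun k => mxvec A 0 k] != 0]; split; first by eexists.
  (* This permutation matrix is pulled to the identity, whose pivots multiply to 1, so the open set
     is nonempty. *)
  exists (perm_mx (s^-1 * c)%g); split; first exact: unitmx_perm.
  exists (lu_pivots (pull _ X)) => //; rewrite pullE.
  suff -> : pull _ (perm_mx (s^-1 * c)%g) = 1%:M by rewrite lu_pivots1 oner_eq0.
  by move=> R; apply/matrixP => i j; rewrite !mxE permM permK (inj_eq perm_inj).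
move=> A [_ [_ -> ]]; rewrite pullE.
move=> /lu_decomposition[L [U [U' [pullA UU' [Llow L1] Uup U'up]]]].
(* [q] sends [c i] to [s i]: it is the renaming that carries the given ideal to the expected one. *)
pose q := (c^-1 * s)%g.
have Aq : A = relabel_mx s L *m (relabel_mx s U *m \matrix_(i, j) (i == q j)%:R).
  rewrite mulmxA -relabel_mxM -pullA; apply/matrixP => i j; rewrite mxE.
  rewrite (bigD1 (q j)) //= !mxE eqxx mulr1 big1 ?addr0 => [|k].
    by rewrite permKV permM permK permKV.
  by rewrite mxE => /negPf ->; rewrite mulr0.
(* Renaming by [q] gives the expected ideal; [U] and its inverse [U'] both map that ideal into
   itself, so only [L] remains. *)
have -> : linear_subst A @` level_ideal p lev =
    linear_subst (relabel_mx s L) @` level_ideal p (lev \o c \o s^-1%g).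
  have qlev : level_ideal p (lev \o c \o s^-1%g) =
      msym q @` level_ideal p lev :> set {mpoly F[N]}.
    rewrite msym_level_ideal; congr level_ideal; apply/boolp.funext => i /=.
    by rewrite invMg invgK permM.
  have lev_s (i j : 'I_N) : (i < j)%N ->
      ((lev \o c \o s^-1%g) (s i) <= (lev \o c \o s^-1%g) (s j))%N.
    by move=> ij; rewrite /= !permK lev_c.
  have upper (B : 'M[F]_N) : is_trig_mx B^T -> forall i j : 'I_N, (j < i)%N -> B i j = 0.
    by move=> /is_trig_mxP B0 i j ji; have := B0 j i ji; rewrite mxE.
  rewrite Aq; apply/seteqP; split=> _ [f If <-].
    exists (linear_subst (relabel_mx s U) (msym q f)).
      by apply: (level_ideal_upper lev_s (upper _ Uup)); rewrite qlev; exists f.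
    by rewrite !linear_substM linear_subst_perm.
  have := level_ideal_upper lev_s (upper _ U'up) If; rewrite {1}qlev => -[h Ih hE].
  exists h => //; rewrite !linear_substM linear_subst_perm hE; congr linear_subst.
  by rewrite -linear_substM -relabel_mxM UU' relabel_mx1 linear_subst1.
apply: initial_ideal_lower_subst => [i|i j neq_ij]; first by rewrite mxE L1.
(* A nonzero off-diagonal entry of [L] lies below the diagonal, so ['X_i] is ranked after ['X_j]. *)
rewrite mxE => Lij; have /ranks : (s^-1%g j < s^-1%g i)%N; last by rewrite !permKV.
rewrite ltn_neqAle (inj_eq val_inj) (inj_eq perm_inj) eq_sym neq_ij leqNgt.
by apply: contra Lij => ij; rewrite (is_trig_mxP Llow).
Qed.

Lemma level_idealXE lev i :
  level_ideal p lev ('X_i : {mpoly F[N]}) <-> lev i = 0%N.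
Proof.
have p_gt1 := prime_gt1 (pcharf_prime chFp).
split; last exact: level_idealX.
move=> /monomial_idealX[_ [[j j0 ->]|[j [k [_ _ ->]]]|[j _ ->]]].
- by move=> /mnm_lepP/(_ j); rewrite !mnm1E eqxx; case: eqP => // ->.
- by move=> /lem_leo/lemc_mdeg; rewrite mdegD !mdeg1.
- by move=> /lem_leo/lemc_mdeg; rewrite mdegMn !mdeg1 mul1n leqNgt p_gt1.
Qed.

(** Squares separate level 1 from higher levels only for [p > 2]: when [p = 2] the square of every
    variable is in the ideal. *)
Lemma level_idealX2E lev i : (2 < p)%N ->
  level_ideal p lev ('X_i * 'X_i : {mpoly F[N]}) <-> (lev i <= 1)%N.
Proof.
move=> p_gt2; split=> [|i1]; last exact: level_idealXM.
rewrite -mpolyXD.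
move=> /monomial_idealX[_ [[j j0 ->]|[j [k [j1 _ ->]]]|[j _ ->]]].
- move=> /mnm_lepP/(_ j); rewrite !mnmDE !mnm1E eqxx.
  by have [->|//] := eqVneq i j; rewrite j0.
- move=> /mnm_lepP/(_ j); rewrite !mnmDE !mnm1E eqxx.
  by have [->|//] := eqVneq i j; rewrite j1.
- by move=> /lem_leo/lemc_mdeg; rewrite mdegMn mdegD !mdeg1 mul1n leqNgt p_gt2.
Qed.

(** The variables in the ideal mark level 0, and the squares in it then mark level 1. When [p = 2]
    the hypotheses exclude level 1 and the first test suffices. *)
Lemma level_ideal_inj lev lev' :
    (forall i, (lev i <= 2)%N) -> (forall i, (lev' i <= 2)%N) ->
    (forall i, lev i = 1%N -> (2 < p)%N) -> (forall i, lev' i = 1%N -> (2 < p)%N) ->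
  level_ideal p lev = level_ideal p lev' :> set {mpoly F[N]} -> lev = lev'.
Proof.
move=> le2 le2' p_gt2 p_gt2' eqI; apply/boolp.funext => i.
have e0 : lev i = 0%N <-> lev' i = 0%N by rewrite -!level_idealXE eqI.
have e1 : (2 < p)%N -> (lev i <= 1)%N <-> (lev' i <= 1)%N.
  by move=> p2; rewrite -!level_idealX2E // eqI.
move: e0 e1 (le2 i) (le2' i) (p_gt2 i) (p_gt2' i).
by case: (lev i) (lev' i) => [|[|[|?]]] [|[|[|?]]] // e0 e1 _ _ h h';
  do [by case: e0 => + _; move=> /(_ erefl) | by case: e0 => _; move=> /(_ erefl)
     | by have /e1[+ _] := h erefl; move=> /(_ erefl)
     | by have /e1[_] := h' erefl; move=> /(_ erefl)].
Qed.

End GenericInitialIdeals.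

(** * The Hilbert ideal as a level ideal *)

Section HilbertIdealLevels.
Variables l m : nat.

(* Level 0 holds all the x_i, level 1 the y_i of the copies of V_3, and level 2
   the remaining variables. *)
Definition var_level (v : 'I_(nvars l m)) : nat :=
  if (v < l + m)%N then 0%N
  else if (l + m + l <= v < l + m + (l + m))%N then 1%N else 2%N.

Lemma var_level_le2 v : (var_level v <= 2)%N.
Proof. by rewrite /var_level; case: ifP => //; case: ifP. Qed.

Lemma var_level_x i : var_level (xv i) = 0%N.
Proof. by rewrite /var_level /= ltn_ord. Qed.

Lemma var_level_y2 i : var_level (yv (lshift m i)) = 2%N.
Proof. by have ltil := ltn_ord i; rewrite /var_level !ifF //=; lia. Qed.

Lemma var_level_y3 i : var_level (yv (rshift l i)) = 1%N.
Proof.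
by have ltil := ltn_ord i; rewrite /var_level ifF ?ifT //=; lia.
Qed.

Lemma var_level_z i : var_level (zv l i) = 2%N.
Proof.
by have ltil := ltn_ord i; rewrite /var_level !ifF //=; lia.
Qed.

Lemma varP (v : 'I_(nvars l m)) :
  [\/ exists i, v = xv i, exists i, v = yv (lshift m i),
      exists i, v = yv (rshift l i) | exists i, v = zv l i].
Proof.
have [i ->|w ->] := split_ordP v; first by apply: Or41; exists i.
have [y ->|i ->] := split_ordP w; last by apply: Or44; exists i.
by have [i ->|i ->] := split_ordP y; [apply: Or42|apply: Or43]; exists i.
Qed.

Lemma L_gens_level (F : fieldType) p :
  L_gens l m F p = [set 'X_[a] | a in level_gens p var_level].
Proof.
apply/seteqP; split=> [f|_ [_ [[v v0 ->]|[v [w [v1 w1 ->]]]|[v v2 ->]] <-]].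
- case=> [[i ->]|[i ->]|[i [j [_ ->]]]|[i ->]].
  + by exists U_(xv i)%MM => //; apply: Or31; exists (xv i); rewrite ?var_level_x.
  + exists (U_(yv (lshift m i)) *+ p)%MM; last by rewrite mpolyXn.
    by apply: Or33; exists (yv (lshift m i)); rewrite ?var_level_y2.
  + exists (U_(yv (rshift l i)) + U_(yv (rshift l j)))%MM; last by rewrite mpolyXD.
    by apply: Or32; exists (yv (rshift l i)), (yv (rshift l j)); rewrite !var_level_y3.
  + exists (U_(zv l i) *+ p)%MM; last by rewrite mpolyXn.
    by apply: Or33; exists (zv l i); rewrite ?var_level_z.
- case: (varP v) v0 => -[i ->].
  + by move=> _; apply: Or41; exists i.
  + by rewrite var_level_y2.
  + by rewrite var_level_y3.
  + by rewrite var_level_z.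
- have y3 u : var_level u = 1%N -> exists i, u = yv (rshift l i).
    case: (varP u) => -[i ->]; first by rewrite var_level_x.
    + by rewrite var_level_y2.
    + by exists i.
    + by rewrite var_level_z.
  have [[i ->] [j ->]] := (y3 v v1, y3 w w1).
  rewrite mpolyXD; apply: Or43.
  (* [level_gens] takes ordered pairs and [L_gens] only [i <= j], so the factors may have to be
     swapped. *)
  by have [ij|/ltnW ji] := leqP i j; [exists i, j|exists j, i; rewrite mulrC].
- rewrite -mpolyXn; case: (varP v) v2 => -[i ->].
  + by rewrite var_level_x.
  + by move=> _; apply: Or42; exists i.
  + by rewrite var_level_y3.
  + by move=> _; apply: Or44; exists i.
Qed.

(** A single copy of V_2 has levels 0, 2 and a single copy of V_3 has levels 0, 1, 2, so no level
    occurs twice. *)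
Lemma var_level_inj : (l + m <= 1)%N -> injective var_level.
Proof.
move=> lm v w; case: (varP v) => -[i ->]; case: (varP w) => -[j ->];
  rewrite ?(var_level_x, var_level_y2, var_level_y3, var_level_z) // => _;
  apply/val_inj => /=; have ltil := ltn_ord i; have ltjl := ltn_ord j; lia.
Qed.

End HilbertIdealLevels.

(** * Existence, number and shape of the generic initial ideals *)

Unset Implicit Arguments.

Theorem proposition4 (p : nat) (F : fieldType)
    (hp : p \in [pchar F]) (hF : infinite_set [set: F])
    (gT : finGroupType) (G : {group gT}) (g : gT)
    (hG : #|G| = p) (hg : generator G g)
    (l m : nat) (V : mx_representation F G (nvars l m))
    (hV2 : forall i : 'I_l, spans_dual_copy g V (V2_vars m i))
    (hV3 : forall r : 'I_m, spans_dual_copy g V (V3_vars l r))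
    (hL : hilbert_ideal V = ideal_gen (L_gens l m F p)) :
  [/\ exists mo : monomial_order (nvars l m), borel_fixed mo (hilbert_ideal V),
      forall mo : monomial_order (nvars l m),
        exists! J, is_gin mo (hilbert_ideal V) J,
      ranked_generic_initial_ideals (hilbert_ideal V) #= `I_((2 * l + 3 * m)`!),
      (l + m <= 1)%N ->
        generic_initial_ideals (hilbert_ideal V) #= `I_((2 * l + 3 * m)`!)
    & forall J, generic_initial_ideals (hilbert_ideal V) J <->
        exists s : 'S_(nvars l m), J = ideal_gen (msym s @` L_gens l m F p)].
Proof.
have p_gt1 := prime_gt1 (pcharf_prime hp).
pose lev := @var_level l m.
(* A variable of level 1 belongs to a copy of V_3, which exists only for [3 <= p]. *)
have p_gt2 v : lev v = 1%N -> (2 < p)%N.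
  case: (varP v) => -[i ->]; rewrite /lev ?var_level_x ?var_level_y2 ?var_level_z // => _.
  by have [] := hV3 i; rewrite hG.
have nvarsE : (2 * l + 3 * m = nvars l m)%N.
  rewrite /nvars !mulSn !mul0n !addn0; lia.
have -> : hilbert_ideal V = level_ideal p (lev) by rewrite hL L_gens_level.
have [||c lev_c] := @sorting_perm (nvars l m)
    (fun v w => (lev v <= lev w)%N).
- by move=> v w; exact: leq_total.
- by move=> w v u; exact: leq_trans.
(* The variable [s i] receives the level of [c i], so levels increase along the ranking [s]. *)
pose gin (s : 'S_(nvars l m)) : set {mpoly F[nvars l m]} :=
  level_ideal p (lev \o c \o s^-1%g).
have is_gin_gin mo s : ranking mo s -> is_gin mo (level_ideal p (lev)) (gin s).
  exact: is_gin_level_ideal.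
have ginE mo s J : ranking mo s -> is_gin mo (level_ideal p (lev)) J -> J = gin s.
  by move=> /is_gin_gin ginS ginJ; exact: (is_gin_uniq hF ginJ ginS).
have genericE : generic_initial_ideals (level_ideal p (lev)) = gin @` setT.
  apply/seteqP; split=> [J [mo moJ]|_ [s _ <-]].
    by have [s ranks] := ranking_exists mo; exists s => //; rewrite (ginE _ _ _ ranks moJ).
  by have [mo ranks] := monomial_order_of_ranking s; exists mo; exact: is_gin_gin.
split.
- have [mo rankc] := monomial_order_of_ranking c.
  by exists mo; exact: level_ideal_borel_fixed rankc.
- move=> mo; have [s ranks] := ranking_exists mo.
  by exists (gin s); split=> [|J /(ginE _ _ _ ranks)]; first exact: is_gin_gin.
(* Each ideal is paired with its ranking, so injectivity comes from the first component. *)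
- rewrite nvarsE; apply: (@card_eq_injective_perm _ _ (fun s => (s, gin s))).
    by move=> s t [].
  apply/seteqP; split=> [[s J] [mo ranks moJ]|_ [s _ <-]].
    by exists s => //; rewrite -(ginE _ _ _ ranks moJ).
  by have [mo ranks] := monomial_order_of_ranking s; exists mo => //; exact: is_gin_gin.
- move=> lm1; rewrite nvarsE genericE; apply: (card_eq_injective_perm (f := gin)) => // s t.
  have le2 (r : 'S_(nvars l m)) v :
    ((lev \o c \o r^-1%g) v <= 2)%N by exact: var_level_le2.
  (* Equal ideals have equal level functions, and with at most one variable per level these
     determine the permutation. *)
  move=> /(level_ideal_inj hp (le2 s) (le2 t)) eq_lev.
  apply: invg_inj; apply/permP => v; apply: (@perm_inj _ c).
  apply: (var_level_inj lm1).
  by apply: (congr1 (@^~ v) (eq_lev _ _)) => w; exact: p_gt2.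
- move=> J; rewrite genericE.
  (* Renaming by [s] gives the ideal of the ranking [c] followed by [s]; as [s] varies, these
     rankings exhaust all permutations. *)
  have msymE s : ideal_gen (msym s @` L_gens l m F p) = gin (c * s)%g.
    rewrite L_gens_level -(image_ideal_gen _ (msymK s)) msym_level_ideal.
    by congr level_ideal; apply/boolp.funext => v /=; rewrite invMg permM permKV.
  split=> [[s _ <-]|[s ->]]; last by exists (c * s)%g.
  by exists (c^-1 * s)%g; rewrite msymE mulgA mulgV mul1g.
Qed.
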